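(* Let $(\mathbb{X}, \|\cdot\|)$ be a finite dimensional real normed linear space of dimension at least $2$, and let $\lambda > 0$. Then $\mu_{\mathbb{X}}(\lambda) = \max\{2+\lambda, 1+2\lambda\}$ if and only if there exist two points $u, v \in S_{\mathbb{X}}$ such that $\|tu+(1-t)v\| = 1$ for all $t \in (0,1)$ and $\|u-v\| = 2$.
   Context: $S_{\mathbb{X}} = \{x \in \mathbb{X} : \|x\| = 1\}$ is the unit sphere of $\mathbb{X}$. For $x,y \in \mathbb{X}$, $x$ is Birkhoff-James orthogonal to $y$, written $x \perp_B y$, if $\|x\| \leq \|x+\alpha y\|$ for all $\alpha \in \mathbb{R}$. The rectangular modulus of $\mathbb{X}$ is the function $\mu_{\mathbb{X}} : (0,\infty) \to \mathbb{R}$ given by $$\mu_{\mathbb{X}}(\lambda) = \sup\left\{ \max\left\{ \frac{\lambda^2+t}{\|\lambda u + t v\|}, \frac{1+\lambda^2 t}{\|u+\lambda t v\|} \right\} : t > 0,\ u, v \in S_{\mathbb{X}},\ u \perp_B v \right\}.$$ *)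

(* Defs.v *)
From HB Require Import structures.
From mathcomp Require Import all_boot all_order all_algebra.
From mathcomp Require Import all_classical all_reals all_analysis.
Set Implicit Arguments.
Unset Strict Implicit.
Unset Printing Implicit Defensive.
Import Order.TTheory GRing.Theory Num.Theory.
Import numFieldNormedType.Exports.
Local Open Scope classical_set_scope.
Local Open Scope ring_scope.

(* The norm is part of the NormedModule structure and is otherwise arbitrary;
   Vector only adds a linear isomorphism with a space of row vectors. *)
#[short(type="finDimNormedModType")]
HB.structure Definition FinDimNormedModule (R : realType) :=
  {X of NormedModule R X & Vector R X}.

Definition unit_sphere (R : realType) (X : normedModType R) : set X :=
  [set x | `|x| = 1].
Arguments unit_sphere {R} X _.

Definition birkhoff_james_orth (R : realType) (X : normedModType R) (x y : X) :
    Prop :=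
  forall alpha : R, `|x| <= `|x + alpha *: y|.

(* Meaningful for 0 < lambda: the constraints on u, v and t then give
   `|lambda *: u + t *: v| >= lambda and `|u + (lambda * t) *: v| >= 1, so no
   denominator vanishes, and the set is bounded above. *)
Definition rectangular_modulus (R : realType) (X : normedModType R)
    (lambda : R) : R :=
  sup [set m | exists (t : R) (u v : X),
    [/\ 0 < t, unit_sphere X u, unit_sphere X v, birkhoff_james_orth u v &
        m = Num.max ((lambda ^+ 2 + t) / `|lambda *: u + t *: v|)
                    ((1 + lambda ^+ 2 * t) / `|u + (lambda * t) *: v|)]].
Arguments rectangular_modulus {R} X lambda.

(* Main.v *)
(** Substituting [s] for [t / lambda] and for [lambda * t], both quotients become
    [(a + b * s) / `|u + s *: v|] with [{a, b} = {lambda, 1}].  Orthogonality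
    gives [`|u + s *: v| >= 1] and the triangle inequality gives
    [`|u + s *: v| >= s - 1], so the quotient is at most [a + 2 * b], with
    equality only for [s = 2] and [`|u + 2 *: v| = 1]; then [u] and [u + 2 *: v]
    span a segment of length 2 in the sphere.  Conversely such a segment [[u, v]]
    attains the bound with the direction [(v - u) / 2].  In finite dimension
    [`|u + 2 *: v|] attains its minimum over orthogonal pairs; if this minimum
    exceeds 1, the quotients stay uniformly below the bound. *)
Require Import Defs.
From mathcomp Require Import all_boot all_order all_algebra.
From mathcomp Require Import all_classical all_reals all_analysis.
From mathcomp Require Import ring lra.
Import Order.TTheory GRing.Theory Num.Theory.
Import VectorInternalTheory.
Import numFieldNormedType.Exports.
Local Open Scope ring_scope.

(** Here [g] stands for [|u + s *: v|] and [d] for a lower bound on its excess over 1 at [s = 2]. If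
    [s] is at distance at least [d / 2] from 2, the bound [1] or [s - 1] leaves enough room; nearer
    to 2, the third bound gives [1 + d / 2 <= g]. *)
Lemma affine_ratio_gap (R : realType) (a b d s g : R) :
    0 <= a -> 0 <= b -> 0 <= d <= 1 ->
    1 <= g -> s - 1 <= g -> 1 + d - `|s - 2| <= g ->
  (a + b * s) / g <= a + b * 2 - b * d / 4.
Proof.
move=> a0 b0 /andP[d0 d1] g1 gs gd; rewrite ler_pdivrMr; last lra.
have bd : 0 <= b * d by exact: mulr_ge0.
have bdb : b * d <= b by rewrite ler_piMr.
have mono x : x <= g ->
    (a + b * 2 - b * d / 4) * x <= (a + b * 2 - b * d / 4) * g.
  by move=> xg; apply: ler_wpM2l xg; lra.
have [sd|sd] := lerP s (2 - d / 2).
  by apply: le_trans (mono 1 g1); nra.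
have [ds|ds] := lerP (2 + d / 2) s.
  by apply: le_trans (mono _ gs); nra.
have gd2 : 1 + d / 2 <= g.
  apply: le_trans gd; have : `|s - 2| <= d / 2 by rewrite ler_norml; lra.
  lra.
by apply: le_trans (mono _ gd2); nra.
Qed.

(** * Orthogonality and the norm along a line *)

Section NormedModule.
Context {R : realType} {X : normedModType R}.
Implicit Types (u v x y : X) (s t : R).

Lemma closed_birkhoff_james_orth :
  closed [set p : X * X | birkhoff_james_orth p.1 p.2]%classic.
Proof.
have -> : [set p : X * X | birkhoff_james_orth p.1 p.2]%classic =
    (\bigcap_(a in [set: R])
       [set p : X * X | 0 <= `|p.1 + a *: p.2| - `|p.1|])%classic.
  apply/seteqP; split => p /=; first by move=> h a _ /=; rewrite subr_ge0.
  by move=> h a; rewrite -subr_ge0; exact: h.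
apply: closed_bigI => a _.
apply: (@preimage_closed _ _ (fun p : X * X => `|p.1 + a *: p.2| - `|p.1|)
  [set y | 0 <= y]%classic); last exact: closed_ge.
move=> p _; apply: cvgB; last by apply: cvg_norm; exact: cvg_fst.
apply: cvg_norm; apply: cvgD; first exact: cvg_fst.
by apply: cvgZl_tmp; exact: cvg_snd.
Qed.

Lemma norm_addZ_ge u v s :
  unit_sphere X u -> unit_sphere X v -> s - 1 <= `|u + s *: v|.
Proof.
rewrite /unit_sphere /= => u1 v1; have := lerB_dist (s *: v) (- u).
rewrite opprK normrN u1 normrZ v1 mulr1 addrC [u + _]addrC.
by have := ler_norm s; rewrite ![- 1 + _]addrC; lra.
Qed.

Lemma norm_addZ_lipschitz u v s t : unit_sphere X v ->
  `|u + t *: v| - `|s - t| <= `|u + s *: v|.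
Proof.
rewrite /unit_sphere /= => v1.
have := lerB_dist (u + t *: v) (u + s *: v).
have -> : u + t *: v - (u + s *: v) = (t - s) *: v.
  by rewrite opprD addrACA subrr add0r scalerBl.
by rewrite normrZ v1 mulr1 distrC; lra.
Qed.

(** The line through [u] in this direction meets [v] at parameter 2. The norm is 1 between the two
    points, at least 1 before [u] by convexity, and at least 1 beyond [v] by the triangle
    inequality. *)
Lemma birkhoff_james_orth_segment u v :
    unit_sphere X u -> unit_sphere X v -> `|u - v| = 2 ->
    (forall t, 0 < t < 1 -> `|t *: u + (1 - t) *: v| = 1) ->
  birkhoff_james_orth u (2^-1 *: (v - u)).
Proof.
rewrite /unit_sphere /= => u1 v1 uv seg a; rewrite u1.
set w := _ *: (v - u).
have wE b : u + b *: w = (1 - b / 2) *: u + (b / 2) *: v.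
  by rewrite /w scalerA scalerBr scalerBl scale1r addrA addrAC.
have w1 : unit_sphere X w.
  by rewrite /unit_sphere /w /= normrZ distrC uv ger0_norm ?mulVf //; lra.
have [a0|a0] := ltrP a 0.
  have m1 : `|u + w| = 1.
    rewrite -[w]scale1r wE -[X in X *: v](_ : 1 - (1 - 1 / 2) = _); last lra.
    by apply: seg; lra.
  (* By convexity: [u] lies between [u + a *: w] and the midpoint [u + w]. *)
  have : `|(1 - a) *: u| <= `|u + a *: w| + `|(- a) *: (u + w)|.
    suff -> : (1 - a) *: u = (u + a *: w) + (- a) *: (u + w) by exact: ler_normD.
    by rewrite scalerDr addrACA scaleNr scaleNr addrN addr0 scalerBl scale1r.
  rewrite !normrZ u1 m1 !gtr0_norm; lra.
have [a2|a2] := ltrP a 2; last first.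
  by have := norm_addZ_ge u w a u1 w1; lra.
have [->|an0] := eqVneq a 0; first by rewrite scale0r addr0 u1.
rewrite wE -[X in X *: v](_ : 1 - (1 - a / 2) = _); last lra.
rewrite seg //; move: an0; rewrite neq_lt; lra.
Qed.

(** The triangle inequality bounds the norm above by 1. The point also equals
    [u + ((1 - t) * 2) *: v], so orthogonality bounds it below by 1. *)
Lemma segment_birkhoff_james_orth u v :
    unit_sphere X u -> unit_sphere X v -> birkhoff_james_orth u v ->
    `|u + 2 *: v| <= 1 ->
  forall t, 0 < t < 1 -> `|t *: u + (1 - t) *: (u + 2 *: v)| = 1.
Proof.
rewrite /unit_sphere /= => u1 v1 uv h t t01; apply/eqP; rewrite eq_le.
apply/andP; split.
  rewrite (le_trans (ler_normD _ _))// !normrZ u1 !gtr0_norm; nra.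
rewrite scalerDr addrA -scalerDl scalerA.
have -> : t + (1 - t) = 1 by lra.
by rewrite scale1r -u1; exact: uv.
Qed.

(** The factor [1 *] gives the numerator the shape [a + b * s] of [affine_ratio_gap]. *)
Lemma rectangular_ratioE (lambda t : R) u v : 0 < lambda ->
  (lambda ^+ 2 + t) / `|lambda *: u + t *: v| =
  (lambda + 1 * (t / lambda)) / `|u + (t / lambda) *: v|.
Proof.
move=> l0; have ln0 : lambda != 0 by rewrite gt_eqF.
have -> : lambda *: u + t *: v = lambda *: (u + (t / lambda) *: v).
  by rewrite scalerDr scalerA mulrC divfK.
rewrite normrZ gtr0_norm // invfM [LHS]mulrA; congr (_ * _).
by field.
Qed.

(** Taking [d = 0] gives the general upper bound, and [d > 0] a uniform gap below it. The slope [b]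
    is 1 in one quotient and [lambda] in the other, hence [Num.min 1 lambda]. *)
Lemma rectangular_ratio_le (lambda d t : R) u v :
    0 < lambda -> 0 <= d <= 1 -> 0 < t ->
    unit_sphere X u -> unit_sphere X v -> birkhoff_james_orth u v ->
    1 + d <= `|u + 2 *: v| ->
  Num.max ((lambda ^+ 2 + t) / `|lambda *: u + t *: v|)
          ((1 + lambda ^+ 2 * t) / `|u + (lambda * t) *: v|)
    <= Num.max (2 + lambda) (1 + 2 * lambda) - Num.min 1 lambda * d / 4.
Proof.
move=> l0 d01 t0 u1 v1 uv h.
have gap a b s : 0 <= a -> 0 <= b ->
    (a + b * s) / `|u + s *: v| <= a + b * 2 - b * d / 4.
  move=> a0 b0; apply: affine_ratio_gap => //.
  - by have := uv s; rewrite u1.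
  - exact: norm_addZ_ge.
  - have := norm_addZ_lipschitz u v s 2 v1; lra.
have [d0 d1] := andP d01.
have lV : lambda != 0 by rewrite gt_eqF.
rewrite ge_max; apply/andP; split.
  rewrite rectangular_ratioE //.
  apply: le_trans (gap lambda 1 (t / lambda) _ _) _; [lra|lra|].
  apply: lerB; first by rewrite le_max mul1r addrC lexx.
  by rewrite !ler_wpM2r // ge_min lexx.
rewrite expr2 -mulrA.
apply: le_trans (gap 1 lambda (lambda * t) _ _) _; [lra|lra|].
apply: lerB; first by rewrite le_max [2 * _]mulrC lexx orbT.
by rewrite !ler_wpM2r // ge_min lexx orbT.
Qed.

End NormedModule.

(** * Compactness in finite dimension *)

Section FiniteDimension.
Context {R : realType}.

Lemma continuous_sumZ {X : normedModType R} {T : topologicalType} {I : Type}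
    (r : seq I) (g : I -> T -> R) (a : I -> X) :
  (forall i, continuous (g i)) ->
  continuous (fun x => \sum_(i <- r) g i x *: a i).
Proof.
move=> gc x; elim: r => [|i r IH].
  by under eq_fun do rewrite big_nil; exact: cvg_cst.
under eq_fun do rewrite big_cons.
by apply: cvgD IH; apply: cvgZr_tmp; exact: gc.
Qed.

Lemma linear_rV_continuous {X : normedModType R} {n : nat}
  (f : {linear 'rV[R]_n -> X}) : continuous f.
Proof.
have -> : f = (fun x => \sum_(i < n) x 0 i *: f (delta_mx 0 i)) :> (_ -> _).
  apply/funext => x; rewrite {1}[x]row_sum_delta linear_sum.
  by apply: eq_bigr => i _; rewrite linearZ.
by apply: continuous_sumZ => i; exact: coord_continuous.
Qed.

Context {X : finDimNormedModType R}.

(** The sphere is the image under [r2v] of a closed set of row vectors; that set is bounded because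
    the two norms are comparable. *)
Lemma compact_unit_sphere : compact (unit_sphere X).
Proof.
pose f : {linear 'rV[R]_(dim X) -> X} := r2v.
have fc : continuous f := linear_rV_continuous f.
have finj : injective f := @r2v_inj R X.
have nfc : continuous (fun x => `|f x|).
  by move=> x; apply: continuous_comp; [exact: fc|exact: norm_continuous].
pose S := [set x : 'rV[R]_(dim X) | `|x| = 1]%classic.
have cS : compact S.
  apply: bounded_closed_compact.
    by exists 1; split => // M /ltW M1 x /= ->.
  apply: (@preimage_closed _ _ (fun x : 'rV[R]_(dim X) => `|x|)
    [set y | y = 1]%classic); last exact: closed_eq.
  by move=> x _; exact: norm_continuous.
(* The constant is the minimum of [|f x|] on the unit sphere of row vectors, positive by injectivity
   of [f]. *)
have [c c0 cf] : exists2 c : R, 0 < c & forall x, c * `|x| <= `|f x|.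
  have normalize x : x != 0 -> S (`|x|^-1 *: x).
    by move=> x0; rewrite /S /= normrZ normfV normr_id mulVf ?normr_eq0.
  have [S0|S0] := pselect (S !=set0)%classic.
    have [x0 /set_mem Sx0 minx0] :=
      compact_EVT_min S0 cS (continuous_subspaceT nfc).
    exists `|f x0|.
      rewrite normr_gt0 -(linear0 f) (inj_eq finj) -normr_eq0.
      by rewrite (_ : `|x0| = 1) ?oner_eq0.
    move=> x; have [->|xn0] := eqVneq x 0.
      by rewrite normr0 mulr0 normr_ge0.
    have := minx0 _ (mem_set (normalize _ xn0)).
    by rewrite linearZ normrZ normfV normr_id ler_pdivlMl ?normr_gt0 // mulrC.
  (* Without unit row vectors every row vector is zero, so any constant works. *)
  exists 1 => // x; have [->|xn0] := eqVneq x 0.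
    by rewrite normr0 mulr0 normr_ge0.
  by exfalso; apply: S0; exists (`|x|^-1 *: x); exact: normalize.
have -> : unit_sphere X = (f @` [set x | `|f x| = 1])%classic.
  apply/seteqP; split => [y y1|_ [x fx1 <-] //].
  by exists (v2r y); rewrite /= v2rK.
apply: continuous_compact; first exact: continuous_subspaceT.
apply: bounded_closed_compact.
  exists c^-1; split; first exact: num_real.
  move=> M /ltW cM x /= fx; apply: le_trans cM.
  by rewrite -[c^-1]mulr1 ler_pdivlMl // -fx.
apply: (@preimage_closed _ _ (fun x => `|f x|) [set y | y = 1]%classic);
  last exact: closed_eq.
by move=> x _; exact: nfc.
Qed.

Lemma birkhoff_james_orth_gap :
    (forall u v, unit_sphere X u -> unit_sphere X v ->
      birkhoff_james_orth u v -> 1 < `|u + 2 *: v|) ->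
  exists2 d : R, 0 < d <= 1 & forall u v, unit_sphere X u ->
    unit_sphere X v -> birkhoff_james_orth u v -> 1 + d <= `|u + 2 *: v|.
Proof.
move=> gt1.
pose K := ((unit_sphere X `*` unit_sphere X) `&`
  [set p : X * X | birkhoff_james_orth p.1 p.2])%classic.
have cK : compact K.
  apply: compact_closedI; last exact: closed_birkhoff_james_orth.
  by apply: compact_setX; exact: compact_unit_sphere.
have [K0|K0] := pselect (K !=set0)%classic; last first.
  exists 1; first by rewrite ltr01 lexx.
  by move=> u v u1 v1 uv; exfalso; apply: K0; exists (u, v).
have gc : continuous (fun p : X * X => `|p.1 + 2 *: p.2|).
  move=> p; apply: cvg_norm; apply: cvgD; first exact: cvg_fst.
  by apply: cvgZl_tmp; exact: cvg_snd.
have [[a b] /set_mem [[/= a1 b1] /= ab] minK] :=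
  compact_EVT_min K0 cK (continuous_subspaceT gc).
(* The excess at the minimizing pair, cut off at 1 to meet the range that [affine_ratio_gap] asks
   for. *)
exists (Num.min 1 (`|a + 2 *: b| - 1)).
  by rewrite lt_min ge_min ltr01 lexx subr_gt0 gt1.
move=> u v u1 v1 uv.
have /= := minK (u, v) (mem_set (conj (conj u1 v1) uv)).
have : Num.min 1 (`|a + 2 *: b| - 1) <= `|a + 2 *: b| - 1.
  by rewrite ge_min lexx orbT.
lra.
Qed.

End FiniteDimension.

Theorem corollary3p4 (R : realType) (X : finDimNormedModType R)
    (dimX : (2 <= \dim {: X})%N) (lambda : R) (lambda_gt0 : 0 < lambda) :
  rectangular_modulus X lambda = Num.max (2 + lambda) (1 + 2 * lambda) <->
  exists u v : X,
    [/\ unit_sphere X u, unit_sphere X v,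
        (forall t : R, 0 < t < 1 -> `|t *: u + (1 - t) *: v| = 1) &
        `|u - v| = 2].
Proof.
set M := Num.max _ _.
have M0 : 0 < M by rewrite /M lt_max; apply/orP; left; lra.
have bound (m : R) : (exists (t : R) (u v : X),
    [/\ 0 < t, unit_sphere X u, unit_sphere X v, birkhoff_james_orth u v &
        m = Num.max ((lambda ^+ 2 + t) / `|lambda *: u + t *: v|)
                    ((1 + lambda ^+ 2 * t) / `|u + (lambda * t) *: v|)]) ->
    m <= M.
  move=> [t [u [v [t0 u1 v1 uv ->]]]].
  (* With [d = 0] the gap hypothesis is [1 <= |u + 2 *: v|], an instance of orthogonality. *)
  have := rectangular_ratio_le lambda 0 t u v lambda_gt0.
  rewrite mulr0 mul0r subr0; apply => //; first by rewrite lexx ler01.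
  by rewrite addr0 -u1; exact: uv.
rewrite /rectangular_modulus; set A := (X in sup X).
split=> [supA|[u [v [u1 v1 seg uv]]]].
  apply: contrapT => noseg.
  have [|d /andP[d0 d1] gap] := birkhoff_james_orth_gap (X := X).
    (* An orthogonal pair violating the strict inequality would produce the excluded segment, from
       [u] to [u + 2 *: v]. *)
    move=> u v u1 v1 uv; rewrite ltNge; apply/negP => h; apply: noseg.
    exists u, (u + 2 *: v); split => //.
    - rewrite /unit_sphere /=; apply/eqP; rewrite eq_le h.
      by rewrite -[X in X <= _]u1; exact: uv.
    - exact: segment_birkhoff_james_orth.
    - by rewrite opprD addrA subrr sub0r normrN normrZ v1 mulr1 ger0_norm.
  have e0 : 0 < Num.min 1 lambda * d / 4.
    by rewrite divr_gt0 // mulr_gt0 // lt_min ltr01.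
  (* The supremum of the empty set is 0 by convention, which differs from [M > 0]. *)
  have [A0|A0] := pselect (A !=set0)%classic; last first.
    suff A_eq0 : A = set0 by move: supA; rewrite A_eq0 sup0; lra.
    by apply/seteqP; split => // m Am; apply: A0; exists m.
  have : sup A <= M - Num.min 1 lambda * d / 4.
    apply: ge_sup => // m [t [x [y [t0 x1 y1 xy ->]]]].
    by apply: rectangular_ratio_le => //; [rewrite (ltW d0)|exact: gap].
  by rewrite supA; lra.
(* Chosen so that [u + 2 *: w = v]. *)
pose w := 2^-1 *: (v - u).
have uw : birkhoff_james_orth u w by exact: birkhoff_james_orth_segment.
have w1 : unit_sphere X w.
  by rewrite /unit_sphere /w /= normrZ distrC uv ger0_norm ?mulVf //; lra.
have uw2 : `|u + 2 *: w| = 1.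
  by rewrite /w scalerA divff // scale1r addrC subrK.
have attained t : 0 < t -> A (Num.max
    ((lambda ^+ 2 + t) / `|lambda *: u + t *: w|)
    ((1 + lambda ^+ 2 * t) / `|u + (lambda * t) *: w|)).
  by move=> t0; exists t, u, w.
have lV : lambda != 0 by rewrite gt_eqF.
have ubA : has_ubound A by exists M => m /bound.
apply/eqP; rewrite eq_le; apply/andP; split.
  by apply: ge_sup; [eexists; exact: (attained 1 ltr01)|move=> m /bound].
rewrite /M ge_max; apply/andP; split.
  (* This [t] puts the first quotient at [s = t / lambda = 2], where its denominator contributes
     norm 1 and its value is [lambda + 2]. *)
  apply: le_trans (ub_le_sup ubA (attained (lambda * 2) _)); last by nra.
  rewrite le_max rectangular_ratioE // [lambda * 2]mulrC mulfK // uw2.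
  by apply/orP; left; lra.
(* This [t] puts the second quotient at [s = lambda * t = 2], with value [1 + 2 * lambda]. *)
apply: le_trans (ub_le_sup ubA (attained (2 / lambda) _)).
  rewrite le_max [lambda * _]mulrC divfK // uw2 divr1 expr2 -mulrA.
  by rewrite [lambda * (2 / _)]mulrC divfK // mulrC lexx orbT.
by rewrite divr_gt0.
Qed.
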